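(* Given a finite simplicial complex $\mathcal{K}$, a metric on its realization $|\mathcal{K}|$, and $\epsilon>0$, there exists $N\in\mathbb{N}$ such that every simplex $\tau$ of the $N$th barycentric subdivision $\operatorname{Bsd}^{N}(\mathcal{K})$ has diameter $\operatorname{diam}(\tau)<\epsilon$ (with respect to the given metric).
   Context: For a set $J$, $\mathbb{E}^J$ is the vector space of all $(x_\alpha)_{\alpha\in J}\in\mathbb{R}^J$ with $x_\alpha=0$ for all but finitely many $\alpha$, with the metric $|x-y|=\max_{\alpha\in J}|x_\alpha-y_\alpha|$. A (geometric) simplicial complex $\mathcal{K}$ in $\mathbb{E}^J$ is a collection of (closed, nonempty) simplices in $\mathbb{E}^J$, closed under taking faces, such that any two simplices of $\mathcal{K}$ intersect either in the empty set or in a common face. Its realization $|\mathcal{K}|\subset\mathbb{E}^J$ is the union of its simplices. The barycenter of a simplex $\sigma=[v_0v_1\dots v_p]$ is $b_\sigma=\frac{1}{p+1}\sum_{i=0}^p v_i$. The $p$-skeleton $\mathcal{K}^{(p)}$ is the subcomplex of simplices of dimension at most $p$. Barycentric subdivision: set $\mathcal{L}_0=\mathcal{K}^{(0)}$. Given a complex $\mathcal{L}_p$ subdividing $\mathcal{K}^{(p)}$, for each $(p+1)$-simplex $\sigma\in\mathcal{K}$ let $\mathcal{L}_\sigma=\{\tau\in\mathcal{L}_p:\tau\subset\operatorname{Bd}(\sigma)\}$, where $\operatorname{Bd}(\sigma)$ is the union of the proper faces of $\sigma$, and let the cone $b_\sigma\ast\mathcal{L}_\sigma$ be the collection of all simplices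 spanned by $b_\sigma$ together with the vertices of some $\tau\in\mathcal{L}_\sigma$, and all faces of such simplices. Define $$\mathcal{L}_{p+1}=\mathcal{L}_p\cup\bigcup_{\sigma\in\mathcal{K},\ \dim\sigma=p+1}(b_\sigma\ast\mathcal{L}_\sigma).$$ Then $\operatorname{Bsd}(\mathcal{K})=\bigcup_{p\ge0}\mathcal{L}_p$; it is a simplicial complex with the same underlying space $|\mathcal{K}|$. Iterates: $\operatorname{Bsd}^1(\mathcal{K})=\operatorname{Bsd}(\mathcal{K})$ and $\operatorname{Bsd}^n(\mathcal{K})=\operatorname{Bsd}(\operatorname{Bsd}^{n-1}(\mathcal{K}))$ for $n\ge2$.
   Formalization: The metric on |K| is assumed to induce the topology that |K| has as a subspace of E^J; for an arbitrary metric, such as the discrete metric on a segment with ε = 1/2, the claim is false. *)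

(* Defs.v *)
From HB Require Import structures.
From mathcomp Require Import all_boot all_order all_algebra finmap.
From mathcomp Require Import all_classical all_reals ereal topology normedtype.

Set Implicit Arguments.
Unset Strict Implicit.
Unset Printing Implicit Defensive.

Import Order.TTheory GRing.Theory Num.Theory.
Import numFieldNormedType.Exports.

Local Open Scope classical_set_scope.
Local Open Scope ring_scope.

Definition finitely_supported (R : realType) (J : Type) : {pred J -> R^o} :=
  [pred x | `[< finite_set [set a | x a != 0] >]].

(* R^o carries the module structure of R over itself; the metric of E^J is the
   one of EJ_norm. *)
Record EJ (R : realType) (J : Type) := MkEJ {
  EJ_fun :> J -> R^o;
  EJ_finite : EJ_fun \in @finitely_supported R J
}.

Section EJ_normed.
Context {R : realType} {J : Type}.

Lemma finitely_supported_submod :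
  submod_closed (@finitely_supported R J).
Proof.
split=> [|k x y /asboolP xf /asboolP yf]; apply/asboolP.
  by rewrite (_ : [set _ | _] = set0) //; apply/seteqP; split=> a //=; rewrite eqxx.
apply: (@sub_finite_set _ _ ([set a | x a != 0] `|` [set a | y a != 0])).
  move=> a /= ha; apply: contrapT => /not_orP[/negP + /negP].
  rewrite !negbK => /eqP x0 /eqP y0; move: ha.
  by rewrite [_ a](_ : _ = k *: x a + y a) // x0 y0 scaler0 addr0 eqxx.
by rewrite finite_setU.
Qed.

HB.instance Definition _ := GRing.isSubmodClosed.Build R (J -> R^o)
  (@finitely_supported R J) finitely_supported_submod.

HB.instance Definition _ := [isSub for @EJ_fun R J].
HB.instance Definition _ := [Choice of EJ R J by <:].
HB.instance Definition _ := [SubChoice_isSubLmodule of EJ R J by <:].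

(* The supremum is a maximum (and is 0 when J is empty). *)
Definition EJ_norm (x : EJ R J) : R := sup [set `|x a| | a in [set: J]].

Lemma EJ_norm_has_ubound (x : EJ R J) :
  has_ubound [set `|x a| | a in [set: J]].
Proof.
case: x => x /= /asboolP xf.
have : finite_set [set `|x a| | a in [set a | x a != 0]].
  exact: finite_image.
move=> /finite_fsetP[X HX].
exists (\sum_(r <- X) `|r|) => _ [a _ <-].
have Xge0 : 0 <= \sum_(r <- X) `|r| by exact: sumr_ge0.
have [->|xa0] := eqVneq (x a) 0; first by rewrite normr0.
have xX : `|x a| \in X.
  suff : [set` X] `|x a| by [].
  by rewrite -HX; exists a.
rewrite (big_fsetD1 _ xX) /= normr_id lerDl.
exact: sumr_ge0.
Qed.

Lemma EJ_norm_ge (x : EJ R J) a : `|x a| <= EJ_norm x.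
Proof. by apply: ub_le_sup; [exact: EJ_norm_has_ubound | exists a]. Qed.

Lemma EJ_norm_le (x : EJ R J) (M : R) :
  0 <= M -> (forall a, `|x a| <= M) -> EJ_norm x <= M.
Proof.
move=> M0 xM; rewrite /EJ_norm.
have [->|/set0P ne] := eqVneq [set `|x a| | a in [set: J]] set0.
  by rewrite sup0.
by apply: ge_sup => // _ [a _ <-].
Qed.

Lemma EJ_norm_ge0 (x : EJ R J) : 0 <= EJ_norm x.
Proof.
rewrite /EJ_norm.
have [->|/set0P[_ [a _ _]]] := eqVneq [set `|x a| | a in [set: J]] set0.
  by rewrite sup0.
exact: le_trans (normr_ge0 (x a)) (EJ_norm_ge x a).
Qed.

Lemma EJ_normD (x y : EJ R J) : EJ_norm (x + y) <= EJ_norm x + EJ_norm y.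
Proof.
apply: EJ_norm_le => [|a]; first by rewrite addr_ge0 ?EJ_norm_ge0.
rewrite [(x + y) a](_ : _ = x a + y a) //.
by rewrite (le_trans (ler_normD _ _)) // lerD ?EJ_norm_ge.
Qed.

Lemma EJ_normZ (k : R) (x : EJ R J) : EJ_norm (k *: x) = `|k| * EJ_norm x.
Proof.
have le k' y : EJ_norm (k' *: y) <= `|k'| * EJ_norm y.
  apply: EJ_norm_le => [|a]; first by rewrite mulr_ge0 ?EJ_norm_ge0.
  rewrite [(k' *: y) a](_ : _ = k' * y a) // normrM.
  by rewrite ler_wpM2l ?EJ_norm_ge.
apply/eqP; rewrite eq_le le /=.
have [->|k0] := eqVneq k 0; first by rewrite normr0 mul0r EJ_norm_ge0.
rewrite mulrC -ler_pdivlMr ?normr_gt0 // mulrC -normfV.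
by have := le k^-1 (k *: x); rewrite scalerK.
Qed.

Lemma EJ_norm0_eq0 (x : EJ R J) : EJ_norm x = 0 -> x = 0.
Proof.
move=> x0; apply/val_inj/funext => a /=; apply/eqP.
by rewrite -normr_le0 -x0 EJ_norm_ge.
Qed.

HB.instance Definition _ := Lmodule_isNormed.Build R (EJ R J)
  EJ_normD EJ_normZ EJ_norm0_eq0.

End EJ_normed.

Section simplices.
Context {R : realType} {E : lmodType R}.
Implicit Types (V W : {fset E}) (s t : set E) (K L : set (set E)).

Definition affinely_independent V := forall c : E -> R,
  \sum_(v <- V) c v = 0 -> \sum_(v <- V) c v *: v = 0 ->
  forall v, v \in V -> c v = 0.

Definition convex_hull V : set E := [set x | exists c : E -> R,
  [/\ forall v, v \in V -> 0 <= c v, \sum_(v <- V) c v = 1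
    & x = \sum_(v <- V) c v *: v]].

Definition simplex_on V s :=
  [/\ V != fset0%fset, affinely_independent V & s = convex_hull V].

Definition is_simplex s := exists V, simplex_on V s.

(* The empty set if s is not a simplex; well defined by verticesE below. *)
Definition vertices s : {fset E} := xget fset0%fset [set V | simplex_on V s].

Definition dim s : nat := #|` vertices s|.-1.

Definition face t s :=
  exists W, [/\ W != fset0%fset, (W `<=` vertices s)%fset & t = convex_hull W].

Definition Bd s : set E := \bigcup_(t in [set t | face t s /\ t <> s]) t.

Definition barycenter s : E :=
  #|` vertices s|%:R^-1 *: \sum_(v <- vertices s) v.

Definition simplicial_complex K := [/\ forall s, K s -> is_simplex s,
  forall s t, K s -> face t s -> K t
  & forall s t, K s -> K t ->
      s `&` t = set0 \/ face (s `&` t) s /\ face (s `&` t) t].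

Definition realization K : set E := \bigcup_(s in K) s.

Definition skeleton K p : set (set E) := [set s | K s /\ (dim s <= p)%N].

Definition cone (b : E) L : set (set E) :=
  [set r | exists t s,
    [/\ L t, simplex_on (b |` vertices t)%fset s & face r s]].

Fixpoint Bsd_skeleton K p : set (set E) :=
  if p is q.+1 then
    let L := Bsd_skeleton K q in
    L `|` \bigcup_(s in [set s | K s /\ dim s = q.+1])
       cone (barycenter s) [set t | L t /\ t `<=` Bd s]
  else skeleton K 0.

Definition Bsd K : set (set E) := \bigcup_p Bsd_skeleton K p.

Lemma convex_hull_vertex V v : v \in V -> convex_hull V v.
Proof.
move=> vV; exists (fun w => (w == v)%:R); split=> //.
- rewrite (big_fsetD1 v) //= eqxx big_seq big1 ?addr0 // => w.
  by rewrite !inE => /andP[/negbTE -> _].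
- rewrite (big_fsetD1 v) //= eqxx scale1r big_seq big1 ?addr0 // => w.
  by rewrite !inE => /andP[/negbTE -> _]; rewrite scale0r.
Qed.

Lemma convex_hull_inj_sub V W : affinely_independent V ->
  convex_hull V = convex_hull W -> (V `<=` W)%fset.
Proof.
move=> Vi VW; apply/fsubsetP => v vV.
have [c [c0 c1 vE]] : convex_hull W v by rewrite -VW; exact: convex_hull_vertex.
have /choice[g gP] : forall w, exists h : E -> R, w \in W ->
    [/\ forall u, u \in V -> 0 <= h u, \sum_(u <- V) h u = 1
      & w = \sum_(u <- V) h u *: u].
  move=> w; have [wW|_] := boolP (w \in W); last by exists (fun=> 0).
  have [h hP] : convex_hull V w by rewrite VW; exact: convex_hull_vertex.
  by exists h.
pose h u := \sum_(w <- W) c w * g w u.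
have h1 : \sum_(u <- V) h u = 1.
  rewrite exchange_big /= -c1 big_seq [RHS]big_seq; apply: eq_bigr => w wW.
  by have [_ gw _] := gP w wW; rewrite -mulr_sumr gw mulr1.
have hv : v = \sum_(u <- V) h u *: u.
  rewrite {1}vE big_seq.
  under eq_bigr => w wW.
    have [_ _ gw] := gP w wW.
    rewrite {2}gw scaler_sumr; under eq_bigr do rewrite scalerA; over.
  rewrite -big_seq exchange_big /=; apply: eq_bigr => u _.
  by rewrite scaler_suml.
have h0 u : u \in V -> h u - (u == v)%:R = 0.
  apply: (Vi (fun u => h u - (u == v)%:R)).
    rewrite sumrB h1 (big_fsetD1 v) //= eqxx big_seq big1 ?addr0 ?subrr // => w.
    by rewrite !inE => /andP[/negbTE -> _].
  under eq_bigr do rewrite scalerBl.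
  rewrite sumrB -hv (big_fsetD1 v) //= eqxx scale1r big_seq big1 ?addr0 ?subrr //.
  by move=> w; rewrite !inE => /andP[/negbTE -> _]; rewrite scale0r.
have [w wW cw] : exists2 w, w \in W & c w != 0.
  apply: contrapT => nw; move: c1; rewrite big_seq big1.
    by move/esym/eqP; rewrite oner_eq0.
  by move=> w wW; apply/eqP; apply: contrapT => /negP cw; apply: nw; exists w.
have [gw0 gw1 gwE] := gP w wW.
have gwu u : u \in V -> u != v -> g w u = 0.
  move=> uV uv; have := h0 u uV; rewrite (negbTE uv) subr0 => /eqP.
  rewrite /h big_seq psumr_eq0 => [/allP/(_ w wW)|z zW].
    by rewrite wW /= mulf_eq0 (negbTE cw) /= => /eqP.
  by have [gz0 _ _] := gP z zW; rewrite mulr_ge0 ?c0 ?gz0.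
suff <- : w = v by [].
have gwv : g w v = 1.
  rewrite -gw1 (big_fsetD1 v) //= big_seq big1 ?addr0 // => u.
  by rewrite !inE => /andP[uv uV]; exact: gwu.
rewrite gwE (big_fsetD1 v) //= gwv scale1r big_seq big1 ?addr0 // => u.
by rewrite !inE => /andP[uv uV]; rewrite gwu // scale0r.
Qed.

Lemma verticesE V s : simplex_on V s -> vertices s = V.
Proof.
move=> sV; rewrite /vertices; case: xgetP => [W _ /= [_ Wi sW]|/(_ V)//].
have [_ Vi sV'] := sV.
apply/eqP; rewrite eqEfsubset.
by rewrite !convex_hull_inj_sub // -?sW // -sV'.
Qed.

End simplices.

Section metrics.
Context {R : realType}.

Definition is_metric (T : Type) (d : T -> T -> R) :=
  [/\ forall x y, 0 <= d x y, forall x y, d x y = 0 <-> x = y,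
      forall x y, d x y = d y x & forall x y z, d x z <= d x y + d y z].

(* For A a set of a topological space, T := A is the sigma type set_type A,
   whose topology is the subspace topology. *)
Definition induces_topology (T : topologicalType) (d : T -> T -> R) :=
  forall x : T,
    nbhs x = filter_from [set e : R | 0 < e] (fun e => [set y | d x y < e]).

(* Extended-real valued: +oo if the distances are unbounded on A. *)
Definition diameter (T : Type) (d : T -> T -> R) (A : set T) : \bar R :=
  ereal_sup [set (d x y)%:E | x in A & y in A].

End metrics.

(* Main.v *)
(* In a simplex with n + 1 vertices and pairwise vertex distances at most D,
   every point is within n / (n + 1) * D of the barycenter, because v - b is
   1 / (n + 1) times the sum of the n differences v - w over the vertices w
   other than v.  An edge of the subdivision either lies in the boundary of a
   simplex, where induction on the skeleta applies, or joins a barycenter to a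
   point of its simplex.  So if K has dimension at most n, subdividing preserves
   this and multiplies the maximal edge length, which is also the maximal
   diameter, by n / (n + 1) < 1.  The realization being compact, small distances
   in E^J force small d-distances uniformly. *)
Require Import Defs.
From mathcomp Require Import all_boot all_order all_algebra.
From mathcomp Require Import all_classical all_reals ereal topology normedtype.
From mathcomp Require Import finmap sequences.

Set Implicit Arguments.
Unset Strict Implicit.
Unset Printing Implicit Defensive.

(* Makes dim the dimension of a simplex again, not the one of mathcomp.vector. *)
Import Defs.
Import Order.TTheory GRing.Theory Num.Theory.
Import numFieldNormedType.Exports.

Local Open Scope classical_set_scope.
Local Open Scope ring_scope.

(** * Convex hulls, faces and boundaries of simplices *)

Section convex_hulls.
Context {R : realType} {E : lmodType R}.
Implicit Types (V W : {fset E}) (s t : set E) (K : set (set E)).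

(** Extension by zero carries coefficients on a smaller vertex set to a larger one. *)
Lemma sum_fsubset_if (M : nmodType) V W (f : E -> M) : (W `<=` V)%fset ->
  \sum_(v <- V) (if v \in W then f v else 0) = \sum_(v <- W) f v.
Proof.
move=> WV; rewrite -(big_fset_incl _ WV); last by move=> v _ /negbTE ->.
by rewrite big_seq [RHS]big_seq; apply: eq_bigr => v ->.
Qed.

Lemma sum_fsubset_ifZ V W (c : E -> R) : (W `<=` V)%fset ->
  \sum_(v <- V) (if v \in W then c v else 0) *: v = \sum_(v <- W) c v *: v.
Proof.
move=> WV; rewrite -(sum_fsubset_if _ WV); apply: eq_bigr => v _.
by case: ifP => // _; rewrite scale0r.
Qed.

Lemma affinely_independent_sub V W :
  (W `<=` V)%fset -> affinely_independent V -> affinely_independent W.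
Proof.
move=> WV Vi c c0 cv0 v vW.
have := Vi (fun w => if w \in W then c w else 0).
rewrite sum_fsubset_if //.
rewrite sum_fsubset_ifZ // => /(_ c0 cv0 v); rewrite vW; apply.
exact: (fsubsetP WV).
Qed.

Lemma convex_hull_sub V W :
  (W `<=` V)%fset -> convex_hull W `<=` convex_hull V.
Proof.
move=> WV _ [c [c0 c1 ->]].
exists (fun w => if w \in W then c w else 0); split.
- by move=> v _; case: ifP => // /c0.
- by rewrite sum_fsubset_if.
- by rewrite sum_fsubset_ifZ.
Qed.

Lemma simplex_on_vertices s : is_simplex s -> simplex_on (vertices s) s.
Proof. by move=> [V sV]; rewrite (verticesE sV). Qed.

Lemma simplex_vertices_sub s v : is_simplex s -> v \in vertices s -> s v.
Proof.
move=> /simplex_on_vertices[_ _ sE] vs; rewrite sE.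
exact: convex_hull_vertex.
Qed.

Lemma simplex_card_vertices s : is_simplex s -> #|` vertices s| = (dim s).+1.
Proof.
by move=> /simplex_on_vertices[sn0 _ _]; rewrite /dim prednK // cardfs_gt0.
Qed.

Lemma face_simplex_on V s t : simplex_on V s -> face t s ->
  is_simplex t /\ (vertices t `<=` V)%fset.
Proof.
move=> sV [W [Wn0]]; rewrite (verticesE sV) => WV tE.
have tW : simplex_on W t.
  by split=> //; apply: affinely_independent_sub WV _; have [] := sV.
by split; [exists W | rewrite (verticesE tW)].
Qed.

Lemma Bd_sub s : is_simplex s -> Bd s `<=` s.
Proof.
move=> /simplex_on_vertices[_ _ sE] x [t [[W [_ Ws ->]] _]].
by rewrite [in X in _ -> X]sE; exact: convex_hull_sub.
Qed.

End convex_hulls.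

(** * Compactness of hulls, and contraction of the mesh under subdivision *)

Section mesh.
Context {R : realType} {E : normedModType R}.
Implicit Types (V W : {fset E}) (s t : set E) (K : set (set E)) (D : R).

(** The hull is a continuous image of a compact set of coefficient functions: the cube of functions
    from [E] to [[0, 1]], compact by Tychonoff, cut by the closed condition of total mass 1 over
    [V]. *)
Lemma compact_convex_hull V : compact (convex_hull V).
Proof.
pose F := prod_topology (fun _ : E => R).
pose cube : set F := [set c | forall v, (`[0, 1]%classic : set R) (c v)].
pose mass : F -> R := fun c => \sum_(v <- V) c v.
pose comb : F -> E := fun c => \sum_(v <- V) c v *: v.
have cproj v : continuous (fun c : F => c v).
  exact: (@proj_continuous E (fun=> R) v).
have cmass : continuous mass.
  by apply: (@continuous_big R E +%R 0 xpredT (@add_continuous R)) => v _.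
have ccomb : continuous comb.
  apply: (@continuous_big E E +%R 0 xpredT (@add_continuous E)) => v _ c.
  exact: (cvgZr_tmp (cproj v c)).
have -> : convex_hull V = comb @` (cube `&` mass @^-1` [set 1]).
  apply/seteqP; split=> [_ [c [c0 c1 ->]]|_ [c [c01 c1] <-]].
    exists (fun v => if v \in V then c v else 0); last first.
      by rewrite /comb big_seq [RHS]big_seq; apply: eq_bigr => v ->.
    split=> [v /=|]; last first.
      by rewrite -c1 /= /mass big_seq [RHS]big_seq; apply: eq_bigr => v ->.
    rewrite in_itv /=; case: ifPn => vV; last by rewrite lexx ler01.
    (* No weight exceeds 1, since the total is 1 and the others are nonnegative. *)
    rewrite c0 //= -c1 (big_fsetD1 v) //= lerDl big_seq sumr_ge0 // => w.
    by rewrite !inE => /andP[_]; exact: c0.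
  exists c; split=> // v vV.
  by have /= := c01 v; rewrite in_itv /= => /andP[].
apply: continuous_compact; first exact: continuous_subspaceT.
apply: compact_closedI.
  exact: (@tychonoff E (fun=> R) (fun=> `[0, 1]%classic)
    (fun=> @segment_compact R 0 1)).
by apply: (@preimage_closed F R mass) => [c _|]; [exact: cmass|exact: closed_eq].
Qed.

Lemma compact_realization K : (forall s, K s -> is_simplex s) ->
  finite_set K -> compact (realization K).
Proof.
move=> Ks /finite_fsetP[X KX]; rewrite /realization KX bigcup_fset big_seq.
apply: bigsetU_compact => s sX.
have /Ks[V [_ _ ->]] : K s by rewrite KX.
exact: compact_convex_hull.
Qed.

(** As the weights sum to 1, [x - y] is the same convex combination of the vectors [v - y]. *)
Lemma convex_hull_dist_le V (x y : E) D : convex_hull V x ->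
  (forall v, v \in V -> `|v - y| <= D) -> `|x - y| <= D.
Proof.
move=> [c [c0 c1 ->]] VD.
have -> : \sum_(v <- V) c v *: v - y = \sum_(v <- V) c v *: (v - y).
  under [RHS]eq_bigr do rewrite scalerBr.
  by rewrite sumrB -scaler_suml c1 scale1r.
apply: le_trans (ler_norm_sum _ _ _) _.
rewrite -[leRHS]mul1r -c1 mulr_suml big_seq [leRHS]big_seq.
apply: ler_sum => v vV.
by rewrite normrZ ger0_norm ?c0 // ler_wpM2l ?c0 ?VD.
Qed.

Lemma convex_hull_diam_le V (x y : E) D : convex_hull V x -> convex_hull V y ->
  (forall v w, v \in V -> w \in V -> `|v - w| <= D) -> `|x - y| <= D.
Proof.
move=> Vx Vy VD; apply: convex_hull_dist_le Vx _ => v vV.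
by rewrite distrC; apply: convex_hull_dist_le Vy _ => w wV; exact: VD.
Qed.

Lemma barycenter_dist_le s (x : E) D n : is_simplex s -> (dim s <= n)%N ->
  (forall v w, v \in vertices s -> w \in vertices s -> `|v - w| <= D) ->
  s x -> `|x - barycenter s| <= n%:R / n.+1%:R * D.
Proof.
move=> ss sn sD sx; have [_ _ sE] := simplex_on_vertices ss.
rewrite sE in sx; apply: convex_hull_dist_le sx _ => v vs.
have D0 : 0 <= D by apply: le_trans (sD v v vs vs).
have m0 : (dim s).+1%:R != 0 :> R by rewrite pnatr_eq0.
have sv : #|` (vertices s `\ v)%fset| = dim s.
  by have := simplex_card_vertices ss; rewrite (cardfsD1 v) vs add1n => -[].
have -> : v - barycenter s =
    (dim s).+1%:R^-1 *: \sum_(w <- (vertices s `\ v)%fset) (v - w).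
  apply: (scalerI m0); rewrite scalerBr /barycenter simplex_card_vertices //.
  rewrite !scalerA divff // !scale1r sumrB.
  rewrite big_const_seq count_predT iter_addr_0 sv (big_fsetD1 v) //=.
  by rewrite scaler_nat mulrS opprD addrACA subrr add0r.
rewrite normrZ normfV normr_nat.
apply: (@le_trans _ _ ((dim s)%:R / (dim s).+1%:R * D)).
  rewrite [X in _ <= X * _]mulrC -mulrA ler_wpM2l ?invr_ge0 //.
  apply: le_trans (ler_norm_sum _ _ _) _.
  rewrite mulr_natl -[in leRHS]sv -iter_addr_0.
  rewrite -[X in iter X](count_predT (vertices s `\ v)%fset).
  rewrite -big_const_seq big_seq [leRHS]big_seq; apply: ler_sum => w.
  by rewrite !inE => /andP[_ ws]; exact: sD.
(* The ratio [m / (m + 1)] grows with [m], so the dimension may be replaced by its bound [n]. *)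
rewrite ler_wpM2r // ler_pdivrMr ?ltr0n // mulrAC ler_pdivlMr ?ltr0n //.
by rewrite -!natrM ler_nat !mulnS mulnC leq_add2r.
Qed.

(** The dimension bound travels with the edge bound so that the factor [n / (n + 1)] stays the same
    in every iteration. *)
Definition mesh_le K n D := forall s, K s ->
  [/\ is_simplex s, (dim s <= n)%N
    & forall v w, v \in vertices s -> w \in vertices s -> `|v - w| <= D].

Lemma Bsd_mesh_le K n D :
  mesh_le K n D -> mesh_le (Bsd K) n (n%:R / n.+1%:R * D).
Proof.
move=> KD.
(* Dimension at most [p] at stage [p] is part of the induction, so that coning gives dimension at
   most [p + 1]. *)
suff H p : mesh_le (Bsd_skeleton K p) (minn p n) (n%:R / n.+1%:R * D).
  move=> s [p _ /H[ss sp sD]]; split=> //.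
  exact: leq_trans sp (geq_minr _ _).
elim: p => [|p IHp] s /=.
  move=> [/KD[ss sn sD]]; rewrite leqn0 => /eqP s0; split=> //.
    by rewrite s0.
  have := simplex_card_vertices ss; rewrite s0 => /eqP/cardfs1P[u su].
  have us : u \in vertices s by rewrite su inE.
  have D0 : 0 <= D by apply: le_trans (sD u u us us).
  rewrite su => v w; rewrite !inE => /eqP-> /eqP->.
  by rewrite subrr normr0 mulr_ge0 // divr_ge0.
(* A new simplex [s] is a face of the cone from the barycenter of [r] over some [t] in the boundary
   of [r]. *)
move=> [/IHp[ss sp sD]|[r [/KD[rs rn rD] rp] [t [s0 [[Lt tr] s0V fs]]]]].
  by split=> //; apply: leq_trans sp _; rewrite leq_min geq_minr geq_min leqnSn.
have [ts tp tD] := IHp t Lt.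
have [ss ssub] := face_simplex_on s0V fs.
have bD v : v \in vertices t ->
    `|v - barycenter r| <= n%:R / n.+1%:R * D.
  move=> vt; apply: (barycenter_dist_le rs rn rD).
  by apply: (Bd_sub rs); apply: tr; exact: simplex_vertices_sub.
split=> // [|v w /(fsubsetP ssub) + /(fsubsetP ssub)].
  have -> : minn p.+1 n = p.+1 by apply/minn_idPl; rewrite -rp.
  rewrite -ltnS -simplex_card_vertices //.
  apply: leq_trans (fsubset_leq_card ssub) _.
  rewrite cardfsU1 simplex_card_vertices //.
  (* The apex adds at most one vertex to the at most [p + 1] vertices of [t]. *)
  apply: (@leq_add _ _ 1 p.+1); first exact: leq_b1.
  by rewrite ltnS (leq_trans tp) // geq_minl.
have D0 : 0 <= n%:R / n.+1%:R * D.
  have := simplex_card_vertices ts.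
  have [->|[u ut] _] := fset_0Vmem (vertices t); first by rewrite cardfs0.
  by apply: le_trans (bD u ut).
rewrite !inE => /orP[/eqP->|vt] /orP[/eqP->|wt].
- by rewrite subrr normr0.
- by rewrite distrC; exact: bD.
- exact: bD.
- exact: tD.
Qed.

Lemma iter_Bsd_mesh_le K n D N :
  mesh_le K n D -> mesh_le (iter N Bsd K) n ((n%:R / n.+1%:R) ^+ N * D).
Proof.
move=> KD; elim: N => [|N IHN]; first by rewrite mul1r.
by rewrite iterS exprS -mulrA; exact: Bsd_mesh_le.
Qed.

Lemma finite_mesh_le K : (forall s, K s -> is_simplex s) -> finite_set K ->
  exists n D, mesh_le K n D.
Proof.
move=> Ks Kfin.
have /finite_fsetP[X XK] : finite_set (dim @` K) by exact: finite_image.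
(* Every number above [M] bounds the norms on the realization; [M + 1] is taken, and edges are at
   most twice that. *)
have [M [_ KM]] := compact_bounded (compact_realization Ks Kfin).
have {}KM s v : K s -> v \in vertices s -> `|v| <= M + 1.
  move=> sK vs; apply: (KM (M + 1)); first by rewrite ltrDl.
  by exists s => //; apply: simplex_vertices_sub => //; exact: Ks.
exists (\max_(i <- X) i)%N, ((M + 1) + (M + 1)) => s sK.
split=> [||v w vs ws]; first exact: Ks.
  have sX : dim s \in X.
    by suff : [set` X] (dim s) by []; rewrite -XK; exists s.
  exact: (@leq_bigmax_seq _ _ xpredT id).
by apply: le_trans (ler_normB _ _) _; rewrite lerD // (KM s).
Qed.

Lemma finite_iter_Bsd_mesh K (delta : R) : (forall s, K s -> is_simplex s) ->
  finite_set K -> 0 < delta ->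
  exists2 N, (0 < N)%N & forall s, iter N Bsd K s ->
    forall x y, s x -> s y -> `|x - y| < delta.
Proof.
move=> Ks Kfin delta0; have [n [D KD]] := finite_mesh_le Ks Kfin.
have q1 : `|n%:R / n.+1%:R| < 1 :> R.
  by rewrite ger0_norm ?divr_ge0 // ltr_pdivrMr ?ltr0n // mul1r ltr_nat.
have /cvgr0Pnorm_lt/(_ _ delta0)[N _ NP] := cvg_geometric D q1.
(* The successor makes the number of subdivisions positive and is still past the threshold [N] of
   the geometric decay. *)
exists N.+1 => // s /(iter_Bsd_mesh_le KD)[/simplex_on_vertices[_ _ sE] _ sD].
move=> x y; rewrite {1}sE => sx; rewrite sE => sy.
apply: le_lt_trans (convex_hull_diam_le sx sy sD) _.
apply: le_lt_trans (ler_norm _) _; rewrite mulrC.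
by apply: NP => /=.
Qed.

End mesh.

(** * Uniform control of [d] by the norm on a compact set *)

Lemma compact_metric_unif_continuous (R : realType) (E : normedModType R)
    (A : set E) (d : A -> A -> R) (eps : R) :
  compact A -> is_metric d -> induces_topology d -> 0 < eps ->
  exists2 delta : R, 0 < delta &
    forall x y : A, `|val x - val y| < delta -> d x y < eps.
Proof.
move=> /compact_near_coveringP Acover [_ _ dC dD] dtop eps0.
have eps20 : 0 < eps / 2 by rewrite divr_gt0.
pose P (delta : R) (p : E) := forall x y : A, val x = p ->
  `|val x - val y| < delta -> d x y < eps.
(* By compactness, one [delta] serves all of [A] once small [delta] work uniformly near each point
   [p]. *)
have : \forall delta \near 0^'+, A `<=` P delta.
  apply: Acover => p Ap; pose x := SigSub (mem_set Ap) : A.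
  have : nbhs x [set y | d x y < eps / 2] by rewrite dtop; exists (eps / 2).
  (* [V] is open in [E] with trace [U] on [A], so a norm ball inside [V] meets [A] only in points
     [d]-close to [x]. *)
  rewrite nbhsE => -[U [[V oV VU] Ux] Ud].
  have /nbhs_ballP[r /= r0 rV] : nbhs p V.
    by apply: open_nbhs_nbhs; split=> //; move: Ux; rewrite -VU.
  have r20 : 0 < r / 2 by rewrite divr_gt0.
  have near_d y : `|p - val y| < r -> d x y < eps / 2.
    by move=> py; apply: Ud; rewrite -VU; apply: rV; rewrite -ball_normE.
  (* For [q] within [r / 2] of [p] and [delta < r / 2], both [y] and [z] lie within [r] of [p],
     hence within [eps / 2] of [x] for [d]. *)
  exists (ball p (r / 2), [set delta | delta < r / 2]) => /=.
    by split; [exact: nbhsx_ballx|exact: nbhs_right_lt].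
  move=> [q delta] /= [pq deltar] y z yq yz.
  move: pq; rewrite -ball_normE /= -yq => py.
  rewrite (splitr eps); apply: le_lt_trans (dD y x z) _.
  rewrite dC ltrD // near_d //.
    by rewrite (lt_trans py) // ltr_pdivrMr // ltr_pMr // ltr1n.
  rewrite (splitr r) -(subrKA (val y)); apply: le_lt_trans (ler_normD _ _) _.
  by rewrite ltrD // (lt_trans yz).
move=> /filterI/(_ (nbhs_right_gt 0)) AP.
have [delta [Pdelta delta0]] := @filter_ex _ _ (at_right_proper_filter 0) _ AP.
exists delta => // x y xy; apply: (Pdelta (val x) _ x y) => //.
exact: set_valP.
Qed.

Theorem theorem3p4 (R : realType) (J : Type) (K : set (set (EJ R J)))
    (K_complex : simplicial_complex K) (K_finite : finite_set K)
    (d : realization K -> realization K -> R)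
    (d_metric : is_metric d) (d_topology : induces_topology d)
    (eps : R) (eps_gt0 : 0 < eps) :
  exists2 N : nat, (0 < N)%N &
    forall tau : set (EJ R J), iter N Bsd K tau ->
      (diameter d (set_val @^-1` tau) < eps%:E)%E.
Proof.
have [K_simplices _ _] := K_complex.
(* Half of [eps], because the supremum in the diameter turns a strict bound into a weak one. *)
have [|delta delta0 d_delta] := @compact_metric_unif_continuous _ _ _ _ (eps / 2)
  (compact_realization K_simplices K_finite) d_metric d_topology.
  by rewrite divr_gt0.
have [N N0 NP] := finite_iter_Bsd_mesh K_simplices K_finite delta0.
exists N => // tau tauN.
apply: (@le_lt_trans _ _ (eps / 2)%:E); last first.
  by rewrite lte_fin ltr_pdivrMr // ltr_pMr // ltr1n.
apply: ge_ereal_sup => _ [x xtau [y ytau <-]].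
by rewrite lee_fin ltW // d_delta // (NP tau).
Qed.
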